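(* Let $H$ be the Hamiltonian with the preferred-orientation coupling at every vertex of the equilateral metric graph formed by the vertices and edges of the cube, all edges having length $1$. Then the square roots $k$ of the eigenvalues $k^2$ of $H$ are, for large $k$, contained in the intervals $$\left(n\pi-\frac{2\sqrt3}{k}+\mathcal O\!\left(\frac1{k^2}\right),\; n\pi+\frac{2\sqrt3}{k}+\mathcal O\!\left(\frac1{k^2}\right)\right),\qquad n\in\mathbb Z .$$ That is, there exist constants $C,K>0$ such that for every $k\ge K$ for which $k^2$ is an eigenvalue of $H$ there is $n\in\mathbb Z$ with $$|k-n\pi|<\frac{2\sqrt3}{k}+\frac{C}{k^2}.$$
   Context: Graph: the metric graph whose vertices and edges are those of the given Platonic solid in $\mathbb R^3$; each of its $N$ edges is identified with the interval $(0,1)$ (the choice of direction of the identification is immaterial). Operator: $H$ acts on $\bigoplus_{e=1}^N L^2((0,1))$ as $f_e\mapsto -f_e''$ on every edge. Its domain consists of all functions in $\bigoplus_{e=1}^N W^{2,2}((0,1))$ satisfying, at every vertex $v$, the coupling condition $$(U_v-I)\Psi_v+i(U_v+I)\Psi_v'=0,$$ where $\Psi_v\in\mathbb C^d$ is the vector of boundary values at $v$ of the functions on the $d$ edges meeting at $v$ ($d$ is the degree of $v$), and $\Psi_v'\in\mathbb C^d$ is the vector of the corresponding outgoing derivatives, i.e. $f'(0)$ if $v$ corresponds to the endpoint $x=0$ of the edge, and $-f'(1)$ if $v$ corresponds to the endpoint $x=1$. Preferred-orientation coupling: at every vertex the edges are numbered $1,\dots,d$ consecutively in the clockwise cyclic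 order as seen from the exterior of the solid, and $U_v$ is the $d\times d$ cyclic permutation matrix with $(U_v)_{m,m+1}=1$ for $m=1,\dots,d-1$, $(U_v)_{d,1}=1$, and all other entries $0$. Explicitly, with cyclic indices, the coupling condition reads $\psi_{m+1}-\psi_m+i(\psi'_{m+1}+\psi'_m)=0$ for $m=1,\dots,d$. The operator $H$ is self-adjoint with purely discrete spectrum. Only positive eigenvalues $k^2$ with $k>0$ are considered. *)

(* Defs.v *)
From HB Require Import structures.
From mathcomp Require Import all_boot all_order all_algebra.
From mathcomp Require Import complex.
From mathcomp Require Import all_classical all_reals all_analysis.
Import Order.TTheory GRing.Theory Num.Theory.
Import numFieldNormedType.Exports.

Set Implicit Arguments.
Unset Strict Implicit.
Unset Printing Implicit Defensive.

Local Open Scope classical_set_scope.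
Local Open Scope ring_scope.
Local Open Scope complex_scope.

(* Elements of L^2 are handled through representatives R -> R (or R -> R[i]);
   their values outside ]0, 1[ (or [0, 1]) are irrelevant. *)

Definition unit_itv (R : realType) : set R := `]0, 1[.
Arguments unit_itv R : clear implicits.

Definition square_integrable (R : realType) (f : R -> R) : Prop :=
  measurable_fun (unit_itv R) f /\
  (@lebesgue_measure R).-integrable (unit_itv R) (fun x => (f x ^+ 2)%:E).

(* C^1 functions with compact support in ]0, 1[, extended by 0 to R. *)
Definition test_function (R : realType) (phi : R -> R) : Prop :=
  [/\ forall x : R, derivable phi x 1,
      continuous (derive1 phi)
    & exists a b : R, [/\ 0 < a, b < 1 &
        forall x : R, ~ (a <= x <= b) -> phi x = 0]].

Definition weak_derivative (R : realType) (f g : R -> R) : Prop :=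
  forall phi : R -> R, test_function phi ->
    (\int[@lebesgue_measure R]_(x in unit_itv R) (f x * derive1 phi x) =
     - \int[@lebesgue_measure R]_(x in unit_itv R) (g x * phi x))%R.

Definition W12_real (R : realType) (f f1 : R -> R) : Prop :=
  [/\ square_integrable f, square_integrable f1 & weak_derivative f f1].

(* f is in W^{1,2}((0,1); C) with weak derivative f1; since test functions
   may be taken real-valued, this is a condition on real and imaginary parts. *)
Definition W12 (R : realType) (f f1 : R -> R[i]) : Prop :=
  W12_real (fun x => complex.Re (f x)) (fun x => complex.Re (f1 x)) /\
  W12_real (fun x => complex.Im (f x)) (fun x => complex.Im (f1 x)).

Definition W22 (R : realType) (f f1 f2 : R -> R[i]) : Prop :=
  W12 f f1 /\ W12 f1 f2.

Definition continuous01 (R : realType) (f : R -> R[i]) : Prop :=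
  {within `[(0 : R), 1], continuous (fun x => complex.Re (f x) : R)} /\
  {within `[(0 : R), 1], continuous (fun x => complex.Im (f x) : R)}.

(* An edge end is a pair (e, b) : E * bool: b = false stands for the endpoint
   x = 0 of the edge e, and b = true for the endpoint x = 1.
   A d-regular metric graph is given by inc : V -> 'I_d -> E * bool, where
   inc v m is the m-th edge end at the vertex v. *)

Definition boundary_value (R : realType) (E : finType)
    (u : E -> R -> R[i]) (h : E * bool) : R[i] :=
  u h.1 (if h.2 then 1 else 0).

(* u1 is the derivative; this is the derivative taken in the direction
   pointing from the vertex into the edge. *)
Definition outgoing_derivative (R : realType) (E : finType)
    (u1 : E -> R -> R[i]) (h : E * bool) : R[i] :=
  if h.2 then - u1 h.1 1 else u1 h.1 0.

(* ordS is the cyclic successor on 'I_d. *)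
Definition preferred_orientation_mx (R : realType) (d : nat) : 'M[R[i]]_d :=
  \matrix_(i < d, j < d) (j == ordS i)%:R.
Arguments preferred_orientation_mx R d : clear implicits.

Definition coupling_condition (R : realType) (d : nat) (U : 'M[R[i]]_d)
    (Psi Psi' : 'cV[R[i]]_d) : Prop :=
  (U - 1%:M) *m Psi + 'i *: ((U + 1%:M) *m Psi') = 0.

Definition preferred_orientation_coupling (R : realType) (V E : finType)
    (d : nat) (inc : V -> 'I_d -> E * bool) (u u1 : E -> R -> R[i]) : Prop :=
  forall v : V, coupling_condition (preferred_orientation_mx R d)
    (\col_(m < d) boundary_value u (inc v m))
    (\col_(m < d) outgoing_derivative u1 (inc v m)).

(* The graph of H as an unbounded operator: psi is in its domain and
   H psi = phi, both up to null sets. Boundary values are those of the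
   continuous representatives u of psi and u1 of psi' on [0, 1]. *)
Definition hamiltonian (R : realType) (V E : finType) (d : nat)
    (inc : V -> 'I_d -> E * bool) (psi phi : E -> R -> R[i]) : Prop :=
  exists u u1 u2 : E -> R -> R[i],
    [/\ forall e, ae_eq (@lebesgue_measure R) (unit_itv R) (psi e) (u e),
        forall e, [/\ W22 (u e) (u1 e) (u2 e),
                      continuous01 (u e) & continuous01 (u1 e)],
        preferred_orientation_coupling inc u u1
      & forall e, ae_eq (@lebesgue_measure R) (unit_itv R)
                    (phi e) (fun x => - u2 e x)].

Definition is_eigenvalue (R : realType) (V E : finType) (d : nat)
    (inc : V -> 'I_d -> E * bool) (lambda : R) : Prop :=
  exists psi : E -> R -> R[i],
    ~ (forall e, ae_eq (@lebesgue_measure R) (unit_itv R)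
                   (psi e) (fun=> 0)) /\
    hamiltonian inc psi (fun e x => lambda%:C * psi e x).

(* The cube is [0,1]^3: v a is the a-th coordinate of the vertex v, false = 0 and true = 1. *)
Definition cube_vertex : finType := {ffun 'I_3 -> bool}.

(* The edge (v, a) joins v, which has a-th coordinate 0, to the vertex
   obtained by changing that coordinate to 1, and is parametrized by it. *)
Definition cube_edge : finType :=
  {e : cube_vertex * 'I_3 | ~~ e.1 e.2}.

Definition cube_endpoint (h : cube_edge * bool) : cube_vertex :=
  let: (v, a) := val h.1 in [ffun i => if i == a then h.2 else v i].

Definition cube_position (v : cube_vertex) : 'rV[int]_3 :=
  \row_(i < 3) (v i)%:R.

(* The vector from the centre of the cube to v, scaled by 2. *)
Definition cube_outward (v : cube_vertex) : 'rV[int]_3 :=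
  cube_position v *+ 2 - const_mx 1.

(* The unit vector pointing from the edge end h into the edge. *)
Definition cube_direction (h : cube_edge * bool) : 'rV[int]_3 :=
  cube_position (cube_endpoint (h.1, ~~ h.2)) -
  cube_position (cube_endpoint h).

(* The scalar triple product n . (a x b). *)
Definition triple_product (n a b : 'rV[int]_3) : int :=
  \det (\matrix_(i < 3) tnth [tuple n; a; b] i).

(* At each vertex, inc lists its three edge ends in the clockwise cyclic order
   seen from the exterior: looking against the outward vector n at v, the turn
   from a to b is clockwise when n . (a x b) < 0. For three edges, having every
   consecutive turn clockwise determines the cyclic order. *)
Definition cube_clockwise_numbering
    (inc : cube_vertex -> 'I_3 -> cube_edge * bool) : Prop :=
  forall v : cube_vertex,
    [/\ injective (inc v),
        forall m, cube_endpoint (inc v m) = v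
      & forall m, triple_product (cube_outward v)
          (cube_direction (inc v m)) (cube_direction (inc v (ordS m))) < 0].

(* Main.v *)
(** At a vertex of degree 3 the cyclic shift S satisfies S^3 = 1, so the coupling
    condition can be solved for the derivatives: Psi' = i (S - S^-1) Psi, where
    i (S - S^-1) is Hermitian of norm sqrt 3. Along an edge -f'' = k^2 f gives
    k f(1) = k f(0) cos k + f'(0) sin k, and the same from the other end; so if x
    and y denote the values and the outgoing derivatives at all edge ends and J
    exchanges the two ends of every edge, then k J x = (k cos k) x + (sin k) y.
    Since J preserves the norm,
      k^2 sin^2 k |x|^2 = 2 k cos k sin k Re <x, y> + sin^2 k |y|^2,
    with |y| <= sqrt 3 |x|. Hence |sin k| (k^2 - 3) <= 2 sqrt 3 k |cos k|, which
    bounds the distance from k to the nearest multiple of pi. Of the cube only its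
    3-regularity is used.

    That eigenfunctions solve the equation classically follows from the
    du Bois-Reymond lemma. *)

Require Import Defs.
From HB Require Import structures.
From mathcomp Require Import all_boot all_order all_algebra.
From mathcomp Require Import complex ring lra.
From mathcomp Require Import all_classical all_reals all_analysis.
From mathcomp Require Import measurable_realfun.
Import Order.TTheory GRing.Theory Num.Theory.
Import numFieldNormedType.Exports.

Set Implicit Arguments.
Unset Strict Implicit.
Unset Printing Implicit Defensive.

Local Open Scope classical_set_scope.
Local Open Scope ring_scope.
Local Open Scope complex_scope.

(** * Hat functions and their C^1 antiderivatives *)

Lemma is_derive_quadratic_error (R : realType) (f : R -> R) (x d C : R) :
  (forall y, `|f y - f x - d * (y - x)| <= C * (y - x) ^+ 2) ->
  is_derive x 1 f d.
Proof.
move=> Hf.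
have C0 : 0 <= C.
  have := Hf (x + 1); have -> : x + 1 - x = 1 by ring.
  by rewrite expr1n !mulr1; exact: (le_trans (normr_ge0 _)).
have : h^-1 *: (f (h *: 1 + x) - f x) @[h --> 0^'] --> d.
  apply/cvgrPdist_le => e e0.
  near=> h.
  have h0 : h != 0 by near: h; exact: nbhs_dnbhs_neq.
  have hC : `|h| <= e / (C + 1).
    near: h; apply: dnbhs0_le; rewrite divr_gt0//; lra.
  have := Hf (h *: 1 + x); rewrite /GRing.scale/= mulr1 addrK => Hh.
  have -> : d - h^-1 * (f (h + x) - f x) = - (h^-1 * (f (h + x) - f x - d * h)).
    by field.
  rewrite normrN normrM normfV ler_pdivrMl ?normr_gt0//.
  apply: (le_trans Hh); rewrite -real_normK ?num_real// expr2 mulrA mulrC.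
  rewrite ler_wpM2l//.
  rewrite ler_pdivlMr in hC; last lra.
  have := normr_ge0 h; nra.
move=> cvgd; split; first by apply/cvg_ex; exists d.
exact: cvg_lim.
Unshelve. all: by end_near. Qed.

Definition pospart (R : realType) (x : R) : R := Num.max x 0.

(** The squared positive part is differentiable with derivative [2 * pospart x], also at the kink 0.
    An explicit quadratic error passes to linear combinations of translates without case
    analysis. *)
Lemma pospart_sq_error (R : realType) (x y : R) :
  `|pospart y ^+ 2 - pospart x ^+ 2 - 2 * pospart x * (y - x)| <= (y - x) ^+ 2.
Proof.
have := sqr_ge0 (y - x); rewrite /pospart ler_norml.
by case: (leP x 0) => ? ?; case: (leP y 0) => ?; apply/andP; split; nra.
Qed.

(* A second difference of [pospart]: the hat of height r supported on
   [a - r, a + r], written so that its antiderivative is elementary and C^1. *)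
Definition tent (R : realType) (r a t : R) : R :=
  pospart (t - a + r) - 2 * pospart (t - a) + pospart (t - a - r).

Definition tent_prim (R : realType) (r a t : R) : R :=
  (pospart (t - a + r) ^+ 2 - 2 * pospart (t - a) ^+ 2
    + pospart (t - a - r) ^+ 2) / 2.

Lemma is_derive_tent_prim (R : realType) (r a t : R) :
  is_derive t 1 (tent_prim r a) (tent r a t).
Proof.
(* The three errors enter with weights 1, 2, 1 and are halved, which gives the constant 2. *)
apply: (@is_derive_quadratic_error _ _ _ _ 2) => y.
have := pospart_sq_error (t - a + r) (y - a + r).
have := pospart_sq_error (t - a) (y - a).
have := pospart_sq_error (t - a - r) (y - a - r).
have -> : y - a - r - (t - a - r) = y - t by ring.
have -> : y - a - (t - a) = y - t by ring.
have -> : y - a + r - (t - a + r) = y - t by ring.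
rewrite /tent /tent_prim !ler_norml => /andP[? ?] /andP[? ?] /andP[? ?].
apply/andP; split; lra.
Qed.

Lemma tent_ge0 (R : realType) (r a t : R) : 0 <= r -> 0 <= tent r a t.
Proof.
rewrite /tent /pospart => r0.
by case: (leP (t - a + r) 0) => ?; case: (leP (t - a) 0) => ?;
  case: (leP (t - a - r) 0) => ?; lra.
Qed.

Lemma tent_out (R : realType) (r a t : R) : 0 <= r -> r < `|t - a| ->
  tent r a t = 0.
Proof.
rewrite /tent /pospart => r0; rewrite lter_normr => H.
by case: (leP (t - a + r) 0) => ?; case: (leP (t - a) 0) => ?;
  case: (leP (t - a - r) 0) => ?; case/orP: H => ?; lra.
Qed.

Lemma tent_prim_left (R : realType) (r a t : R) : 0 <= r -> t <= a - r ->
  tent_prim r a t = 0.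
Proof.
rewrite /tent_prim /pospart => r0 H.
by case: (leP (t - a + r) 0) => ?; case: (leP (t - a) 0) => ?;
  case: (leP (t - a - r) 0) => ?; lra.
Qed.

(** The value [r ^+ 2] is the mass of the tent. It does not depend on the centre, so two such
    antiderivatives cancel to the right of both tents. *)
Lemma tent_prim_right (R : realType) (r a t : R) : 0 <= r -> a + r <= t ->
  tent_prim r a t = r ^+ 2.
Proof.
move=> r0 H; rewrite /tent_prim /pospart !max_l; try lra.
Qed.

Lemma continuous_tent (R : realType) (r a : R) : continuous (tent r a).
Proof.
have cp (b c : R) : continuous (fun t : R => pospart (t - b + c)).
  move=> t; rewrite /pospart.
  apply: (@continuous_max _ _ (fun t => t - b + c) (cst 0));
    last exact: cvg_cst.
  by apply: cvgD; [apply: cvgB; [exact: cvg_id|]|]; exact: cvg_cst.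
move=> t; apply: cvgD; first apply: cvgB.
- exact: cp.
- apply: cvgM; first exact: cvg_cst.
  by have := cp a 0 t; under eq_fun do rewrite addr0.
- exact: cp.
Qed.

(** * Integrals over the unit interval and against tents *)

Lemma continuous_integrable01 (R : realType) (f : R -> R) :
  {within `[0, 1], continuous f} ->
  (@lebesgue_measure R).-integrable `[0, 1] (EFin \o f).
Proof.
by move=> cf; apply: continuous_compact_integrable => //; exact: segment_compact.
Qed.

(** The endpoints are a null set. Weak derivatives are tested on the open interval, whereas the
    fundamental theorem and integration by parts are applied on the closed one. *)
Lemma Rintegral_unit_itv (R : realType) (f : R -> R) :
  {within `[0, 1], continuous f} ->
  (\int[@lebesgue_measure R]_(x in unit_itv R) f x
   = \int[@lebesgue_measure R]_(x in `[0%R, 1%R]) f x)%R.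
Proof.
move=> /continuous_integrable01 cf.
have cf1 : (@lebesgue_measure R).-integrable `]0, 1] (EFin \o f).
  by apply: integrableS cf => //; exact: subset_itv_oc_cc.
rewrite -Rintegral_itv_obnd_cbnd// -Rintegral_itv_bndo_bndc//.
by apply: integrableS cf1 => //; exact: subset_itv_oo_oc.
Qed.

Lemma within_continuousM (R : realType) (A : set R) (f g : R -> R) :
  {within A, continuous f} -> {within A, continuous g} ->
  {within A, continuous (fun x => f x * g x)}.
Proof. by move=> cf cg x; apply: continuousM; [exact: cf|exact: cg]. Qed.

Lemma within_continuousD (R : realType) (A : set R) (f g : R -> R) :
  {within A, continuous f} -> {within A, continuous g} ->
  {within A, continuous (fun x => f x + g x)}.
Proof. by move=> cf cg x; apply: continuousD; [exact: cf|exact: cg]. Qed.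

Lemma within_continuousB (R : realType) (A : set R) (f g : R -> R) :
  {within A, continuous f} -> {within A, continuous g} ->
  {within A, continuous (fun x => f x - g x)}.
Proof. by move=> cf cg x; apply: continuousB; [exact: cf|exact: cg]. Qed.

Lemma Rintegral_tent (R : realType) (r a : R) :
  0 <= r -> r <= a -> a + r <= 1 ->
  (\int[@lebesgue_measure R]_(x in `[0%R, 1%R]) tent r a x = r ^+ 2)%R.
Proof.
move=> r0 ra ar.
have cQ : continuous (tent_prim r a).
  move=> x; apply/differentiable_continuous/derivable1_diffP.
  by have [] := is_derive_tent_prim r a x.
rewrite /Rintegral (@continuous_FTC2 _ _ (tent_prim r a)) ?ltr01//.
- by rewrite /= tent_prim_right ?tent_prim_left ?subr0//; lra.
- exact/continuous_subspaceT/continuous_tent.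
- split.
  + by move=> x _; have [] := is_derive_tent_prim r a x.
  + exact/cvg_at_right_filter/cQ.
  + exact/cvg_at_left_filter/cQ.
- move=> x _; rewrite derive1E.
  by have [] := is_derive_tent_prim r a x.
Qed.

Lemma Rintegral_mul_tent_le (R : realType) (h : R -> R) (M r a : R) :
  {within `[0, 1], continuous h} ->
  0 <= r -> r <= a -> a + r <= 1 ->
  (forall t, `|t - a| <= r -> h t <= M) ->
  (\int[@lebesgue_measure R]_(x in `[0%R, 1%R]) (h x * tent r a x)
    <= M * r ^+ 2)%R.
Proof.
move=> ch r0 ra ar hM.
have ct : {within `[0, 1], continuous (tent r a)}.
  exact/continuous_subspaceT/continuous_tent.
rewrite -(Rintegral_tent r0 ra ar) -RintegralZl//;
  last exact: continuous_integrable01.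
apply: le_Rintegral => //.
- exact/continuous_integrable01/within_continuousM.
- by apply/continuous_integrable01/within_continuousM => // x; exact: cvg_cst.
- move=> x _; have [xar|xar] := leP (`|x - a|) r.
    by rewrite ler_wpM2r ?tent_ge0 ?hM.
  by rewrite tent_out ?mulr0.
Qed.

Lemma Rintegral_mul_tent_ge (R : realType) (h : R -> R) (M r a : R) :
  {within `[0, 1], continuous h} ->
  0 <= r -> r <= a -> a + r <= 1 ->
  (forall t, `|t - a| <= r -> M <= h t) ->
  (M * r ^+ 2 <=
    \int[@lebesgue_measure R]_(x in `[0%R, 1%R]) (h x * tent r a x))%R.
Proof.
move=> ch r0 ra ar hM.
have ct : {within `[0, 1], continuous (tent r a)}.
  exact/continuous_subspaceT/continuous_tent.
rewrite -(Rintegral_tent r0 ra ar) -RintegralZl//;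
  last exact: continuous_integrable01.
apply: le_Rintegral => //.
- by apply/continuous_integrable01/within_continuousM => // x; exact: cvg_cst.
- exact/continuous_integrable01/within_continuousM.
- move=> x _; have [xar|xar] := leP (`|x - a|) r.
    by rewrite ler_wpM2r ?tent_ge0 ?hM.
  by rewrite tent_out ?mulr0.
Qed.

(** * The du Bois-Reymond lemma *)

Lemma is_derive_tent_prim_diff (R : realType) (r a b t : R) :
  is_derive t 1 (fun x => tent_prim r a x - tent_prim r b x)
    (tent r a t - tent r b t).
Proof.
by apply: is_deriveB; exact: is_derive_tent_prim.
Qed.

Lemma derive1_tent_prim_diff (R : realType) (r a b : R) :
  derive1 (fun x => tent_prim r a x - tent_prim r b x)
  = (fun x => tent r a x - tent r b x).
Proof.
apply/funext => x; rewrite derive1E.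
by have [] := is_derive_tent_prim_diff r a b x.
Qed.

(** Both antiderivatives vanish to the left of the tents and equal the common mass to the right, so
    their difference has compact support. *)
Lemma test_function_tent (R : realType) (r a b : R) :
  0 < r -> r < a -> a + r < 1 -> r < b -> b + r < 1 ->
  test_function (fun x => tent_prim r a x - tent_prim r b x).
Proof.
move=> r0 ra ar rb br; split.
- by move=> x; have [] := is_derive_tent_prim_diff r a b x.
- rewrite derive1_tent_prim_diff => x.
  by apply: cvgB; exact: continuous_tent.
- exists (Num.min a b - r), (Num.max a b + r); split.
  + by rewrite subr_gt0 lt_min ra rb.
  + by rewrite -ltrBrDr gt_max !ltrBrDr ar br.
  + move=> x; have [xl|xl] := ltP x (Num.min a b - r).
      move: xl; rewrite ltrBrDr lt_min => /andP[xa xb] _.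
      by rewrite !tent_prim_left ?subrr//; lra.
    have [xr _|//] := ltP (Num.max a b + r) x.
    move: xr; rewrite -ltrBrDr gt_max => /andP[xa xb].
    by rewrite !tent_prim_right ?subrr//; lra.
Qed.

Lemma near_dist_le (R : realType) (P : R -> Prop) (a : R) :
  (\forall t \near a, P t) ->
  exists2 d : R, 0 < d & forall t, `|t - a| <= d -> P t.
Proof.
move=> /nbhs_ballP[d /= d0 dP]; exists (d / 2); first by rewrite divr_gt0.
move=> t td; apply: dP; rewrite /ball/= distrC.
by apply: le_lt_trans td _; rewrite ltr_pdivrMr//; lra.
Qed.

(* Testing against the difference of two narrow tents of equal mass compares
   the values of h at their centres. *)
Lemma du_Bois_Reymond (R : realType) (h : R -> R) :
  {within `[0, 1], continuous h} ->
  (forall phi, test_function phi ->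
    (\int[@lebesgue_measure R]_(x in `[0%R, 1%R]) (h x * derive1 phi x)
      = 0)%R) ->
  forall a b, a \in `]0, 1[ -> b \in `]0, 1[ -> h a = h b.
Proof.
move=> ch h0 a b.
wlog hab : a b / h b < h a.
  move=> H a01 b01; have [ab|ab|//] := ltgtP (h a) (h b); last exact: H.
  by apply/esym/H.
move=> a01 b01; exfalso.
have /(continuous_within_itvP _ ltr01)[co _ _] := ch.
(* With a third of the gap, [h a - e] still exceeds [h b + e] by [e]. *)
pose e := (h a - h b) / 3; have e0 : 0 < e by rewrite divr_gt0// subr_gt0.
have [da da0 Ha] : exists2 d : R, 0 < d &
    forall t, `|t - a| <= d -> h a - e <= h t.
  apply: near_dist_le; have /cvgrPdist_le/(_ _ e0) := co _ a01.
  by apply: filterS => t; rewrite ler_norml => /andP[]; lra.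
have [db db0 Hb] : exists2 d : R, 0 < d &
    forall t, `|t - b| <= d -> h t <= h b + e.
  apply: near_dist_le; have /cvgrPdist_le/(_ _ e0) := co _ b01.
  by apply: filterS => t; rewrite ler_norml => /andP[]; lra.
move: a01 b01; rewrite !in_itv/= => /andP[a0 a1] /andP[b0 b1].
have [r [[r0 rda rdb] [ra ar rb br]]] : exists r,
    [/\ 0 < r, r <= da & r <= db] /\
    [/\ r < a, a + r < 1, r < b & b + r < 1].
  pose s := Num.min (Num.min da db)
    (Num.min (Num.min a (1 - a)) (Num.min b (1 - b))).
  (* Unfolding only the right-hand [s] yields all six upper bounds at once; halving [s] then makes
     them strict. *)
  have : s <= s by [].
  have : 0 < s by rewrite !lt_min da0 db0 a0 b0 !subr_gt0 a1 b1.
  rewrite {3}/s !le_min => s0 /andP[/andP[? ?] /andP[/andP[? ?] /andP[? ?]]].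
  by exists (s / 2); split; split; lra.
have := h0 _ (test_function_tent r0 ra ar rb br).
have ct c : {within `[0, 1], continuous (tent r c)}.
  exact/continuous_subspaceT/continuous_tent.
rewrite derive1_tent_prim_diff; under eq_Rintegral => x _ do rewrite mulrBr.
rewrite RintegralB//; try exact/continuous_integrable01/within_continuousM.
have := Rintegral_mul_tent_ge ch (ltW r0) (ltW ra) (ltW ar)
  (fun t tr => Ha t (le_trans tr rda)).
have := Rintegral_mul_tent_le ch (ltW r0) (ltW rb) (ltW br)
  (fun t tr => Hb t (le_trans tr rdb)).
(* The two tent integrals are equal by hypothesis, yet the bounds above separate them by at least
   [e * r ^+ 2]. *)
have re : 0 < e * r ^+ 2 by rewrite mulr_gt0 ?exprn_gt0.
have : h a - e = h b + e + e by rewrite /e; field.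
by move: (h a - e) (h b + e) => A B ->; lra.
Qed.

(** * From weak to classical derivatives *)

Lemma test_function_ends (R : realType) (phi : R -> R) : test_function phi ->
  phi 0 = 0 /\ phi 1 = 0.
Proof.
by move=> [_ _ [a [b [a0 b1 H]]]]; split; apply: H => /andP[]; lra.
Qed.

Lemma derivable_continuous (R : realType) (f : R -> R) :
  (forall x, derivable f x 1) -> continuous f.
Proof.
by move=> df x; apply/differentiable_continuous/derivable1_diffP/df.
Qed.

(** If [G] is the integral of [g] from 0, then [f - G] has weak derivative 0, hence is constant on
    the open interval, and [f] inherits the derivative of [G]. *)
Lemma weak_derivative_is_derive (R : realType) (f g : R -> R) :
  {within `[0, 1], continuous f} -> {within `[0, 1], continuous g} ->
  weak_derivative f g ->
  forall x : R, x \in `]0, 1[ -> is_derive x 1 f (g x).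
Proof.
move=> cf cg wfg.
pose G x := (\int[@lebesgue_measure R]_(t in `[0%R, x]) g t)%R.
have cG : {within `[0, 1], continuous G}.
  apply: parameterized_integral_continuous => //.
  exact: continuous_integrable01.
have dG x : x \in `]0, 1[ -> derivable G x 1 /\ derive1 G x = g x.
  rewrite in_itv/= => /andP[x0 x1].
  apply: (continuous_FTC1_closed x1 (continuous_integrable01 cg) x0).
  have /(continuous_within_itvP _ ltr01)[co _ _] := cg.
  by apply: co; rewrite in_itv/= x0.
pose h x := f x - G x.
have ch : {within `[0, 1], continuous h}.
  by move=> x; apply: continuousB; [exact: cf|exact: cG].
have hc : forall a b, a \in `]0, 1[ -> b \in `]0, 1[ -> h a = h b.
  apply: du_Bois_Reymond ch _ => phi tphi.
  have [p0 p1] := test_function_ends tphi.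
  have [dphi cdphi _] := tphi.
  have cphi := derivable_continuous dphi.
  have cphi' : {within `[0, 1], continuous phi} by exact: continuous_subspaceT.
  have cdphi' : {within `[0, 1], continuous (derive1 phi)}.
    exact: continuous_subspaceT.
  have := wfg phi tphi.
  rewrite !Rintegral_unit_itv; try exact: within_continuousM.
  under [in RHS]eq_Rintegral => x _ do rewrite mulrC.
  (* The boundary terms vanish with [phi], so [f] and [G] have the same integral against
     [derive1 phi]. *)
  rewrite (@Rintegration_by_parts _ phi G (derive1 phi) g)//; first last.
  - by move=> x /dG[].
  - have /(continuous_within_itvP _ ltr01)[_ cl cr] := cG.
    by split => // x /dG[].
  - split => //; first exact/cvg_at_right_filter/cphi.
    exact/cvg_at_left_filter/cphi.
  rewrite p0 p1 !mul0r subrr sub0r opprK => E.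
  under eq_Rintegral => x _ do rewrite /h mulrBl.
  rewrite RintegralB//; try exact/continuous_integrable01/within_continuousM.
  rewrite E; apply/eqP; rewrite subr_eq0; apply/eqP.
  by apply: eq_Rintegral => x _; rewrite mulrC.
move=> x x01.
have [dGx Gx] := dG _ x01.
have idG : is_derive x 1 (fun t => G t + h x) (g x).
  rewrite -[g x]addr0; apply: is_deriveD.
  by apply: DeriveDef; [exact: dGx|rewrite -derive1E].
apply: near_eq_is_derive idG.
have := x01; rewrite in_itv/= => /andP[x0 x1].
near=> t.
have t01 : t \in `]0, 1[.
  by near: t; apply: near_in_itvoo.
by rewrite (hc _ _ x01 t01) /h addrC subrK.
Unshelve. all: by end_near. Qed.

(** * The eigenvalue equation on a single edge *)

Lemma derive0_constant01 (R : realType) (f : R -> R) :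
  {within `[0, 1], continuous f} ->
  (forall x : R, x \in `]0, 1[ -> is_derive x 1 f 0) ->
  forall x, x \in `[0, 1] -> f x = f 0.
Proof.
move=> cf df x; rewrite in_itv/= => /andP[x0 x1].
have [|||c _] := @MVT_segment _ f (cst 0) 0 x.
- exact: x0.
- move=> y; rewrite in_itv/= => /andP[y0 yx].
  by apply: df; rewrite in_itv/= y0 (lt_le_trans yx).
- by apply: continuous_subspaceW cf; apply: subset_itvl; rewrite bnd_simp.
- by rewrite mul0r => /eqP; rewrite subr_eq0 => /eqP.
Qed.

(** This allows the second derivative, known only up to null sets, to be replaced by the continuous
    function [- k ^+ 2 * u]. *)
Lemma weak_derivative_ae (R : realType) (f g g' : R -> R) :
  measurable_fun (unit_itv R) g -> measurable_fun (unit_itv R) g' ->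
  ae_eq lebesgue_measure (unit_itv R) g g' ->
  weak_derivative f g -> weak_derivative f g'.
Proof.
move=> mg mg' gg' wfg phi tphi; rewrite (wfg _ tphi); congr (- _).
have [/derivable_continuous cphi _ _] := tphi.
have mphi : measurable_fun (unit_itv R) phi.
  by apply: measurable_funTS; exact: continuous_measurable_fun.
rewrite /Rintegral; congr fine; apply: ae_eq_integral.
- exact: measurable_itv.
- by apply/measurable_EFinP; exact: measurable_funM.
- by apply/measurable_EFinP; exact: measurable_funM.
- by apply: filterS gg' => x /[swap] Dx /(_ Dx) ->.
Qed.

(** The vector with components [k * u x] and [u1 x] rotates with angular speed [k]. Undoing the
    rotation gives two quantities, [w1] and [w2], that are constant on the closed interval; rotating
    back gives the formulas. *)
Lemma helmholtz_solution (R : realType) (k : R) (u u1 u2 : R -> R) :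
  {within `[0, 1], continuous u} -> {within `[0, 1], continuous u1} ->
  W12_real u u1 -> W12_real u1 u2 ->
  ae_eq lebesgue_measure (unit_itv R) u2 (fun x => - k ^+ 2 * u x) ->
  forall x, x \in `[0, 1] ->
    k * u x = k * u 0 * cos (k * x) + u1 0 * sin (k * x) /\
    u1 x = - (k * u 0 * sin (k * x)) + u1 0 * cos (k * x).
Proof.
move=> cu cu1 [[mu _] _ wu] [_ [mu2 _] wu1] u2E.
have cku : {within `[0, 1], continuous (fun x => - k ^+ 2 * u x)}.
  by apply: within_continuousM => // y; exact: cvg_cst.
have mku : measurable_fun (unit_itv R) (fun x => - k ^+ 2 * u x).
  by apply: measurable_funM.
have du := weak_derivative_is_derive cu cu1 wu.
have du1 := weak_derivative_is_derive cu1 cku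
  (weak_derivative_ae mu2 mku u2E wu1).
have dcos (x : R) : is_derive x 1 (fun t => cos (k * t)) (- (k * sin (k * x))).
  by apply: is_derive_eq; rewrite /GRing.scale/=; ring.
have dsin (x : R) : is_derive x 1 (fun t => sin (k * t)) (k * cos (k * x)).
  by apply: is_derive_eq; rewrite /GRing.scale/=; ring.
have ccos : {within `[0, 1], continuous (fun t => cos (k * t))}.
  by apply/continuous_subspaceT/derivable_continuous => x; have [] := dcos x.
have csin : {within `[0, 1], continuous (fun t => sin (k * t))}.
  by apply/continuous_subspaceT/derivable_continuous => x; have [] := dsin x.
pose w1 x := k * u x * cos (k * x) - u1 x * sin (k * x).
pose w2 x := k * u x * sin (k * x) + u1 x * cos (k * x).
have cku0 : {within `[0, 1], continuous (fun x => k * u x)}.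
  by apply: within_continuousM => // y; exact: cvg_cst.
have w1E x : x \in `[0, 1] -> w1 x = w1 0.
  apply: derive0_constant01 => [|y y01].
    by apply: within_continuousB; exact: within_continuousM.
  have := du _ y01; have := du1 _ y01 => d1 d2.
  by apply: is_derive_eq; rewrite /GRing.scale/=; ring.
have w2E x : x \in `[0, 1] -> w2 x = w2 0.
  apply: derive0_constant01 => [|y y01].
    by apply: within_continuousD; exact: within_continuousM.
  have := du _ y01; have := du1 _ y01 => d1 d2.
  by apply: is_derive_eq; rewrite /GRing.scale/=; ring.
move=> x x01; have := w1E x x01; have := w2E x x01.
rewrite /w1 /w2 mulr0 sin0 cos0 !mulr0 !mulr1 subr0 add0r => <- <-.
have := cos2Dsin2 (k * x); set c := cos _; set s := sin _ => cs.
split; last first.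
  transitivity (u1 x * (c ^+ 2 + s ^+ 2)); last by ring.
  by rewrite cs mulr1.
transitivity (k * u x * (c ^+ 2 + s ^+ 2)); last by ring.
by rewrite cs mulr1.
Qed.

(** * The coupling at a vertex of degree 3 *)

Lemma ordS3 (m : 'I_3) : ordS (ordS (ordS m)) = m.
Proof. by apply: val_inj; case: m => -[|[|[|//]]]. Qed.

Lemma preferred_orientation_mxE (R : realType) (d : nat)
    (v : 'cV[R[i]]_d) (m : 'I_d) :
  (preferred_orientation_mx R d *m v) m 0 = v (ordS m) 0.
Proof.
rewrite mxE (bigD1 (ordS m))//= mxE eqxx mul1r big1 ?addr0// => j jm.
by rewrite mxE (negbTE jm) mul0r.
Qed.

(** The alternating sum of the relations at [m], [ordS m] and [ordS (ordS m)] isolates twice the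
    derivative at [m], giving w_m = i (v_{m+1} - v_{m+2}), here split into real and imaginary
    parts. *)
Lemma coupling_condition3 (R : realType) (v w : 'cV[R[i]]_3) :
  coupling_condition (preferred_orientation_mx R 3) v w ->
  forall m, complex.Re (w m 0) =
              complex.Im (v (ordS (ordS m)) 0) - complex.Im (v (ordS m) 0) /\
            complex.Im (w m 0) =
              complex.Re (v (ordS m) 0) - complex.Re (v (ordS (ordS m)) 0).
Proof.
rewrite /coupling_condition mulmxBl mulmxDl !mul1mx => vw.
have {}vw m : v (ordS m) 0 - v m 0 + 'i * (w (ordS m) 0 + w m 0) = 0.
  have := preferred_orientation_mxE v m; have := preferred_orientation_mxE w m.
  move: vw; move: (_ *m v) (_ *m w) => A B /matrixP/(_ m 0).
  by rewrite !mxE => e eB eA; rewrite -eA -eB.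
move=> m; have := vw m; have := vw (ordS m); have := vw (ordS (ordS m)).
rewrite ordS3.
case: (v m 0) (v (ordS m) 0) (v (ordS (ordS m)) 0) => [a b] [a1 b1] [a2 b2].
case: (w m 0) (w (ordS m) 0) (w (ordS (ordS m)) 0) => [c d] [c1 d1] [c2 d2].
move=> /eqP; rewrite eq_complex/= => /andP[/eqP ? /eqP ?].
move=> /eqP; rewrite eq_complex/= => /andP[/eqP ? /eqP ?].
move=> /eqP; rewrite eq_complex/= => /andP[/eqP ? /eqP ?].
by split; lra.
Qed.

Lemma sum_ord3_cycle (R : nmodType) (F : 'I_3 -> R) (m : 'I_3) :
  \sum_i F i = F m + F (ordS m) + F (ordS (ordS m)).
Proof.
rewrite (bigD1 m)//= (bigD1 (ordS m))/=; last first.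
  by case: m => -[|[|[|//]]].
rewrite (bigD1 (ordS (ordS m)))/=; last first.
  by case: m => -[|[|[|//]]].
rewrite big1 ?addr0 ?addrA// => i.
by case: m => -[|[|[|//]]] ?; case: i => -[|[|[|//]]] ?; rewrite -?val_eqE.
Qed.

(* The right-hand side exceeds the left-hand side by the squares of the sums of
   a and of b: the operator S - S^-1 has norm sqrt 3. *)
Lemma sum_sqr_cycle_le (R : realType) (a b : 'I_3 -> R) :
  \sum_m ((b (ordS (ordS m)) - b (ordS m)) ^+ 2
          + (a (ordS m) - a (ordS (ordS m))) ^+ 2)
  <= 3 * \sum_m (a m ^+ 2 + b m ^+ 2).
Proof.
rewrite !(sum_ord3_cycle _ ord0) !ordS3.
have := sqr_ge0 (a ord0 + a (ordS ord0) + a (ordS (ordS ord0))).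
have := sqr_ge0 (b ord0 + b (ordS ord0) + b (ordS (ordS ord0))).
lra.
Qed.

(** * Norm estimates over all edge ends *)

(** Here [X], [Y], [Z] stand for |x|^2, |y|^2 and Re <x, y>. Writing [k ^+ 2 * X] with the factor
    [c ^+ 2 + s ^+ 2] cancels the cosine term; for nonzero [s], division by [|s| * X] then gives the
    bound. *)
Lemma sin_cos_bound (R : realType) (k c s X Y Z : R) :
  0 < k -> 0 < X -> c ^+ 2 + s ^+ 2 = 1 ->
  k ^+ 2 * X = k ^+ 2 * c ^+ 2 * X + 2 * k * c * s * Z + s ^+ 2 * Y ->
  Y <= 3 * X -> `|Z| <= Num.sqrt 3 * X ->
  `|s| * (k ^+ 2 - 3) <= 2 * Num.sqrt 3 * k * `|c|.
Proof.
move=> k0 X0 cs E Y3 Zle.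
have [->|s0] := eqVneq s 0.
  by rewrite normr0 mul0r !mulr_ge0// ?sqrtr_ge0// ltW.
have sp : 0 < `|s| by rewrite normr_gt0.
rewrite -(ler_pM2l sp) -(ler_pM2r X0).
have H1 : c * s * Z <= `|c| * `|s| * (Num.sqrt 3 * X).
  apply: (le_trans (ler_norm _)); rewrite !normrM.
  by rewrite ler_wpM2l ?mulr_ge0.
have H2 : s ^+ 2 * Y <= s ^+ 2 * (3 * X) by rewrite ler_wpM2l ?sqr_ge0.
have s2 : `|s| * `|s| = s ^+ 2 by rewrite -expr2 real_normK ?num_real.
have H3 := ler_wpM2l (ltW k0) H1.
have E2 : k ^+ 2 * X = k ^+ 2 * (c ^+ 2 + s ^+ 2) * X by rewrite cs mulr1.
rewrite !mulrA s2.
move: E E2 H2 H3; lra.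
Qed.

(** Sums over edge ends are rearranged in two ways: grouping by vertex gives [Y <= 3 * X], and
    exchanging the two ends of each edge gives the identity between [X], [Y] and [Z]. Indices 1 and
    2 denote real and imaginary parts. *)
Lemma half_edge_bound (R : realType) (V E : finType)
    (inc : V -> 'I_3 -> E * bool) (k c s : R) (x1 x2 y1 y2 : E * bool -> R) :
  bijective (fun p : V * 'I_3 => inc p.1 p.2) ->
  0 < k -> c ^+ 2 + s ^+ 2 = 1 ->
  (forall h, k * x1 (h.1, ~~ h.2) = k * c * x1 h + s * y1 h) ->
  (forall h, k * x2 (h.1, ~~ h.2) = k * c * x2 h + s * y2 h) ->
  (forall v m,
    y1 (inc v m) = x2 (inc v (ordS (ordS m))) - x2 (inc v (ordS m)) /\
    y2 (inc v m) = x1 (inc v (ordS m)) - x1 (inc v (ordS (ordS m)))) ->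
  (exists h, (x1 h != 0) || (x2 h != 0)) ->
  `|s| * (k ^+ 2 - 3) <= 2 * Num.sqrt 3 * k * `|c|.
Proof.
move=> incb k0 cs xy1 xy2 yx [h0 xh0].
pose X := \sum_h (x1 h ^+ 2 + x2 h ^+ 2).
pose Y := \sum_h (y1 h ^+ 2 + y2 h ^+ 2).
pose Z := \sum_h (x1 h * y1 h + x2 h * y2 h).
have sumV (F : E * bool -> R) : \sum_h F h = \sum_v \sum_m F (inc v m).
  by rewrite pair_big/= (reindex _ (onW_bij _ incb)).
have X0 : 0 < X.
  rewrite /X (bigD1 h0)//= ltr_pwDl//.
    rewrite lt0r paddr_eq0 ?sqr_ge0// !sqrf_eq0 negb_and xh0.
    by rewrite addr_ge0 ?sqr_ge0.
  by apply: sumr_ge0 => h _; rewrite addr_ge0 ?sqr_ge0.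
have Y3 : Y <= 3 * X.
  rewrite /X /Y !sumV mulr_sumr; apply: ler_sum => v _.
  under eq_bigr => m _ do rewrite (yx v m).1 (yx v m).2.
  exact: (sum_sqr_cycle_le (fun m => x1 (inc v m)) (fun m => x2 (inc v m))).
have r3 : Num.sqrt 3 ^+ 2 = 3 :> R by rewrite sqr_sqrtr.
have r0 : 0 < Num.sqrt 3 :> R by rewrite sqrtr_gt0.
(* Expanding the squares of √3 x - e y for e = 1 and e = -1 bounds both signs of [Z]; with
   [Y <= 3 * X] this replaces Cauchy-Schwarz. *)
have ZXY (e : R) : e ^+ 2 = 1 -> 2 * (Num.sqrt 3 * (e * Z)) <= 3 * X + Y.
  move=> e1; rewrite /X /Y /Z !mulr_sumr -big_split/=; apply: ler_sum => h _.
  have := sqr_ge0 (Num.sqrt 3 * x1 h - e * y1 h).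
  have := sqr_ge0 (Num.sqrt 3 * x2 h - e * y2 h).
  have sq (a b : R) : (Num.sqrt 3 * a - e * b) ^+ 2
      = Num.sqrt 3 ^+ 2 * a ^+ 2 - 2 * Num.sqrt 3 * e * a * b + e ^+ 2 * b ^+ 2.
    by ring.
  by rewrite !sq r3 e1; lra.
have Zle : `|Z| <= Num.sqrt 3 * X.
  have r3X : Num.sqrt 3 * (Num.sqrt 3 * X) = 3 * X by rewrite mulrA -expr2 r3.
  have := ZXY 1 (expr1n _ _); have : (-1) ^+ 2 = 1 :> R by rewrite sqrrN expr1n.
  move=> /ZXY; rewrite ler_norml => ? ?.
  by apply/andP; split; rewrite -(ler_pM2l r0); lra.
apply: (sin_cos_bound k0 X0 cs _ Y3 Zle).
have incJ : bijective (fun h : E * bool => (h.1, ~~ h.2)).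
  by exists (fun h => (h.1, ~~ h.2)) => -[e b]/=; rewrite negbK.
(* Only the left-hand [X] is reindexed by the exchange of ends, so that the edge relations can be
   squared term by term. *)
rewrite {1}/X (reindex _ (onW_bij _ incJ))/= /X /Y /Z !mulr_sumr -!big_split/=.
apply: eq_bigr => h _; rewrite mulrDr -!exprMn xy1 xy2; ring.
Qed.

(** Real and imaginary parts of an eigenfunction solve the equation on each edge separately, which
    reduces the claim to finitely many boundary data. *)
Lemma eigenvalue_bound (R : realType) (V E : finType)
    (inc : V -> 'I_3 -> E * bool) (k : R) :
  bijective (fun p : V * 'I_3 => inc p.1 p.2) -> 0 < k ->
  is_eigenvalue inc (k ^+ 2) ->
  `|sin k| * (k ^+ 2 - 3) <= 2 * Num.sqrt 3 * k * `|cos k|.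
Proof.
move=> incb k0 [psi [psi0 [u [u1 [u2 [psiu Wu coup phiu]]]]]].
have u2E e : ae_eq (@lebesgue_measure R) (unit_itv R) (u2 e)
    (fun x => - (k ^+ 2)%:C * u e x).
  move: (psiu e) (phiu e); apply: filterS2 => x + + Dx => /(_ Dx) psix /(_ Dx).
  by rewrite psix mulNr => ->; rewrite opprK.
pose x1 h := complex.Re (boundary_value u h).
pose x2 h := complex.Im (boundary_value u h).
pose y1 h := complex.Re (outgoing_derivative u1 h).
pose y2 h := complex.Im (outgoing_derivative u1 h).
have solR e x : x \in `[0, 1] ->
    k * complex.Re (u e x) =
      k * x1 (e, false) * cos (k * x) + y1 (e, false) * sin (k * x) /\
    complex.Re (u1 e x) =
      - (k * x1 (e, false) * sin (k * x)) + y1 (e, false) * cos (k * x).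
  have [[[Wr _] [W1r _]] [cr _] [c1r _]] := Wu e.
  apply: (helmholtz_solution cr c1r Wr W1r).
  apply: filterS (u2E e) => y + Dy => /(_ Dy) -> /=.
  by case: (u e y) => a b/=; ring.
have solI e x : x \in `[0, 1] ->
    k * complex.Im (u e x) =
      k * x2 (e, false) * cos (k * x) + y2 (e, false) * sin (k * x) /\
    complex.Im (u1 e x) =
      - (k * x2 (e, false) * sin (k * x)) + y2 (e, false) * cos (k * x).
  have [[[_ Wr] [_ W1r]] [_ cr] [_ c1r]] := Wu e.
  apply: (helmholtz_solution cr c1r Wr W1r).
  apply: filterS (u2E e) => y + Dy => /(_ Dy) -> /=.
  by case: (u e y) => a b/=; ring.
have i1 : (1 : R) \in `[0, 1] by rewrite in_itv/= ler01 lexx.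
have cs := cos2Dsin2 k.
have y1t e : y1 (e, true) = - complex.Re (u1 e 1).
  by rewrite /y1 /outgoing_derivative/=; case: (u1 e 1).
have y2t e : y2 (e, true) = - complex.Im (u1 e 1).
  by rewrite /y2 /outgoing_derivative/=; case: (u1 e 1).
have coup' v := coupling_condition3 (coup v).
apply: (half_edge_bound incb k0 cs (x1 := x1) (x2 := x2) (y1 := y1) (y2 := y2)).
(* From the end 1 the relation follows by inverting the rotation by angle [k]; from the end 0 it is
   the solution formula at 1. *)
- case=> e [] /=; have [+ +] := solR e 1 i1; rewrite mulr1.
    rewrite -/(x1 (e, true)) y1t => H1 ->; rewrite [k * _ * _]mulrAC H1.
    by rewrite -[LHS]mulr1 -cs; ring.
  by rewrite -/(x1 (e, true)) => -> _; ring.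
- case=> e [] /=; have [+ +] := solI e 1 i1; rewrite mulr1.
    rewrite -/(x2 (e, true)) y2t => H1 ->; rewrite [k * _ * _]mulrAC H1.
    by rewrite -[LHS]mulr1 -cs; ring.
  by rewrite -/(x2 (e, true)) => -> _; ring.
- by move=> v m; have := coupling_condition3 (coup v) m; rewrite !mxE.
(* If all boundary values vanish, the coupling makes all derivatives vanish too, and the solution
   formula forces the eigenfunction to be zero. *)
- apply/existsP; apply: contra_notT psi0 => /existsPn x0 e.
  have {}x0 h : x1 h = 0 /\ x2 h = 0.
    by have := x0 h; rewrite negb_or !negbK => /andP[/eqP -> /eqP ->].
  have y0 h : y1 h = 0 /\ y2 h = 0.
    case: incb => f _ incf; rewrite -(incf h).
    have := coupling_condition3 (coup (f h).1) (f h).2; rewrite !mxE.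
    by rewrite -!/(x1 _) -!/(x2 _) !(x0 _).1 !(x0 _).2 subrr.
  apply: filterS (psiu e) => x + Dx => /(_ Dx) ->.
  have x01 : x \in `[0, 1] by apply: subset_itv_oo_cc; exact: Dx.
  have [+ _] := solR e x x01; have [+ _] := solI e x x01.
  rewrite !(x0 _).1 !(x0 _).2 !(y0 _).1 !(y0 _).2 !mulr0 !mul0r addr0.
  move=> /eqP; rewrite mulf_eq0 gt_eqF//= => /eqP.
  move=> + /eqP; rewrite mulf_eq0 gt_eqF//= => + /eqP.
  by case: (u e x) => a b /= -> ->.
Qed.

(** * Distance to the multiples of pi *)

(** This is |t| <= |tan t| cleared of its denominator, so that pi / 2 is included. For [0 <= t] it
    holds because sin x - x cos x has derivative x sin x, which is nonnegative there. *)
Lemma normr_mul_cos_le_sin (R : realType) (t : R) :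
  `|t| <= pi / 2 -> `|t| * cos t <= `|sin t|.
Proof.
wlog t0 : t / 0 <= t => [H|].
  have [/H//|/ltW t0] := leP 0 t.
  rewrite -[`|t|]normrN -(cosN t) -(normrN (sin t)) -sinN.
  by apply: H; rewrite oppr_ge0.
rewrite ger0_norm// => tpi.
have pi0 := pi_gt0 R.
have dg (x : R) : is_derive x 1 (fun x => sin x - x * cos x) (x * sin x).
  by apply: is_derive_eq; rewrite /GRing.scale/=; ring.
have [||c] := @MVT_segment _ (fun x => sin x - x * cos x)
    (fun x => x * sin x) 0 t.
- exact: t0.
- by apply/continuous_subspaceT/derivable_continuous => x; have [] := dg x.
rewrite in_itv/= => /andP[c0 ct]; rewrite sin0 mul0r !subr0 => E.
have : 0 <= c * sin c * t.
  by rewrite !mulr_ge0// sin_ge0_pi// c0/=; lra.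
by rewrite -E subr_ge0 => /le_trans; apply; exact: ler_norm.
Qed.

Lemma near_multiple_of_pi (R : realType) (k : R) : 2 <= k ->
  `|sin k| * (k ^+ 2 - 3) <= 2 * Num.sqrt 3 * k * `|cos k| ->
  exists n : int, `|k - n%:~R * pi| < 2 * Num.sqrt 3 / k + 6 / k ^+ 2.
Proof.
move=> k2 H; have k0 : 0 < k by lra.
have pi0 := pi_gt0 R.
have kpi : 0 <= k / pi + 1 / 2 by rewrite addr_ge0// divr_ge0// ltW.
(* The integer nearest to [k / pi], so that the remainder [t] is at most [pi / 2] in absolute
   value. *)
pose n := Num.truncn (k / pi + 1 / 2).
have /andP[n1 n2] := truncn_itv kpi; rewrite -/n in n1 n2.
exists n%:Z; rewrite -[n%:~R]/(n%:R); set t := k - _.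
have tpi : `|t| <= pi / 2.
  have kE : k = k / pi * pi by field; lra.
  rewrite /t {}kE -mulrBl normrM (gtr0_norm pi0) mulrC ler_pM2l//.
  rewrite -[n.+1%:R]natr1 in n2; rewrite ler_norml; apply/andP; split; lra.
have kE : k = t + pi *+ n by rewrite /t -[pi *+ n]mulr_natl subrK.
have t2 : `|t| < 2 by apply: le_lt_trans tpi (pihalf_lt2 R).
(* Shifting by a multiple of pi changes sine and cosine only by a sign, which the absolute values
   remove. *)
move: H; rewrite {1 4}kE (alternatingn (@sinDpi R)) (alternatingn (@cosDpi R)).
rewrite !normrM !normr_sign !mul1r.
have c0 : 0 <= cos t by apply: cos_ge0_pihalf; rewrite -ler_norml.
rewrite (ger0_norm c0) => H.
have k23 : 0 < k ^+ 2 - 3 by nra.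
(* If [cos t] were 0, then [|sin t|] would be 1 and [H] would contradict [0 < k ^+ 2 - 3]. *)
have {c0} cp : 0 < cos t.
  rewrite lt0r c0 andbT; apply/eqP => ct0.
  have := cos2Dsin2 t; rewrite ct0 expr0n add0r => /eqP.
  rewrite sqrf_eq1 => st; move: H; rewrite ct0 mulr0.
  have -> : `|sin t| = 1 by case/orP: st => /eqP ->; rewrite ?normrN normr1.
  lra.
have {}H : `|t| * (k ^+ 2 - 3) <= 2 * Num.sqrt 3 * k.
  rewrite -(ler_pM2r cp); apply: le_trans H.
  by rewrite mulrAC ler_wpM2r ?normr_mul_cos_le_sin// ltW.
(* The constant 6 arises from [|t| * k ^+ 2 <= 2 * Num.sqrt 3 * k + 3 * |t|] and [|t| < 2]. *)
have -> : 2 * Num.sqrt 3 / k + 6 / k ^+ 2 = (2 * Num.sqrt 3 * k + 6) / k ^+ 2.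
  by field; lra.
rewrite ltr_pdivlMr ?exprn_gt0//; lra.
Qed.

(** * The edge ends of the cube and the conclusion *)

(** Injectivity holds because an edge end determines its vertex; surjectivity follows by
    counting. *)
Lemma cube_numbering_bijective
    (inc : cube_vertex -> 'I_3 -> cube_edge * bool) :
  cube_clockwise_numbering inc ->
  bijective (fun p : cube_vertex * 'I_3 => inc p.1 p.2).
Proof.
move=> incP.
have incK v m : cube_endpoint (inc v m) = v by have [_ ->] := incP v.
apply: inj_card_bij => [[v m] [v' m'] /= e|].
  have vv : v = v' by rewrite -(incK v m) e incK.
  by move: e; rewrite -vv; have [inj _ _] := incP v => /inj ->.
(* An edge end is determined by its vertex and its axis: the coordinate along the axis tells which
   end it is, and the initial vertex of the edge has coordinate 0 there. *)
apply: (@leq_card _ _ (fun h => (cube_endpoint h, (val h.1).2))).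
move=> [[[v a] /= va] b] [[[v' a'] /= va'] b'] [ends aa]; subst a'.
have bb : b = b' by move/ffunP: ends => /(_ a); rewrite !ffunE eqxx.
have vv : v = v'.
  apply/ffunP => i; have [->|ia] := eqVneq i a.
    by rewrite (negbTE va) (negbTE va').
  by move/ffunP: ends => /(_ i); rewrite !ffunE (negbTE ia).
by subst b' v'; congr (_, _); exact: val_inj.
Qed.

Theorem theorem4p1 (R : realType)
    (inc : cube_vertex -> 'I_3 -> cube_edge * bool)
    (inc_clockwise : cube_clockwise_numbering inc) :
  exists C K : R, [/\ 0 < C, 0 < K &
    forall k : R, K <= k -> is_eigenvalue inc (k ^+ 2) ->
      exists n : int,
        `| k - n%:~R * pi | < 2 * Num.sqrt 3 / k + C / k ^+ 2].
Proof.
(* The threshold 2 ensures [k ^+ 2 > 3]. *)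
exists 6, 2; split => // k k2 ev; apply: near_multiple_of_pi => //.
apply: eigenvalue_bound ev; last by lra.
exact: cube_numbering_bijective.
Qed.
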